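(* If $n\geq 2$, then \[ 2\binom{n}{\lfloor n/2\rfloor}+1\le \mathrm{La}(n,\{W,M\},\#P_2)\le \mathrm{La}(n,\mathcal{P}_6,\#P_2)\le (2+o(1))\binom{n}{\lfloor n/2\rfloor}. \]
   Context: $2^{[n]}$ is the Boolean lattice of all subsets of $[n]=\{1,\dots,n\}$ ordered by inclusion. A poset $P$ is a (weak) subposet of a poset $Q$ if there is an injection $f:P\to Q$ such that $p\le_P p'$ implies $f(p)\le_Q f(p')$. For a family $\mathcal{S}$ of posets, $\mathcal{F}\subseteq 2^{[n]}$ is $\mathcal{S}$-free if no poset of $\mathcal{S}$ is a weak subposet of $(\mathcal{F},\subseteq)$, and $\mathrm{La}(n,\mathcal{S},\#P_2)$ is the maximum number of pairs $F\subsetneq F'$ with $F,F'\in\mathcal{F}$ over all $\mathcal{S}$-free $\mathcal{F}\subseteq 2^{[n]}$. $\mathcal{P}_k$ denotes the family of all posets on $k$ elements whose undirected Hasse diagram is a path. $W$ is the poset on five elements $a,b,c,d,e$ whose relations are exactly $b<a$, $b<c$, $d<c$, $d<e$; $M$ is its dual, obtained by reversing all relations. The $o(1)$ is as $n\to\infty$. *)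

(* Defs.v *)
From HB Require Import structures.
From mathcomp Require Import all_boot all_order all_algebra.
From mathcomp Require Import all_classical all_reals all_analysis.

Set Implicit Arguments.
Unset Strict Implicit.
Unset Printing Implicit Defensive.

Import Order.TTheory GRing.Theory Num.Theory.

Local Open Scope classical_set_scope.
Local Open Scope order_scope.

Definition finPoset : Type := {d : Order.disp_t & finPOrderType d}.

(* A [Prop]-valued predicate rather than a [set], because [finPoset] is too
   large for the universe of [set]. *)
Definition posetFamily : Type := finPoset -> Prop.

Definition FinPoset (d : Order.disp_t) (P : finPOrderType d) : finPoset :=
  existT _ d P.

Definition weak_subposet (d d' : Order.disp_t)
    (P : finPOrderType d) (Q : finPOrderType d') : Prop :=
  exists f : P -> Q, injective f /\ {homo f : p p' / p <= p'}.

(* The ground set [n] is 'I_n; [members F] is the poset (F, inclusion). *)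
Definition members (n : nat) (F : {set {set 'I_n}}) : Type :=
  {A : {set 'I_n} | A \in F}.

Section MembersOrder.
Variables (n : nat) (F : {set {set 'I_n}}).
Implicit Types A B C : members F.

Definition members_le : rel (members F) := fun A B => val A \subset val B.

Fact members_le_refl : reflexive members_le.
Proof. by move=> A; exact: subxx. Qed.

Fact members_le_anti : antisymmetric members_le.
Proof. by move=> A B AB; apply/val_inj/eqP; rewrite finset.eqEsubset. Qed.

Fact members_le_trans : transitive members_le.
Proof. by move=> B A C; exact: fintype.subset_trans. Qed.

HB.instance Definition _ := Finite.on (members F).
HB.instance Definition _ := @Order.Le_isPOrder.Build (Order.Disp tt tt)
  (members F) members_le members_le_refl members_le_anti members_le_trans.
End MembersOrder.

Definition family_free (n : nat) (S : posetFamily) (F : {set {set 'I_n}}) :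
    Prop :=
  forall P : finPoset, S P -> ~ weak_subposet (projT2 P) (members F).

Definition num_P2 (n : nat) (F : {set {set 'I_n}}) : nat :=
  #|[set X : {set 'I_n} * {set 'I_n}
      | [&& X.1 \in F, X.2 \in F & X.1 \proper X.2]]%SET|.

Definition La_P2 (n : nat) (S : posetFamily) : nat :=
  (\max_(F : {set {set 'I_n}} | `[< family_free S F >]) num_P2 F)%N.

Definition covered_by (d : Order.disp_t) (P : finPOrderType d) : rel P :=
  fun x y => (x < y) && ~~ [exists z : P, (x < z) && (z < y)].

Definition hasse (d : Order.disp_t) (P : finPOrderType d) : rel P :=
  fun x y => covered_by x y || covered_by y x.

Definition path_posets (k : nat) : posetFamily := fun P =>
  exists v : 'I_k -> projT2 P, bijective v /\
    forall i j : 'I_k,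
      hasse (v i) (v j) = (i.+1 == j :> nat) || (j.+1 == i :> nat).

(* The elements 0, 1, 2, 3, 4 stand for a, b, c, d, e. *)
Definition W_type : Type := 'I_5.

Definition W_lt : rel W_type := fun x y =>
  (val x, val y) \in [:: (1, 0); (1, 2); (3, 2); (3, 4)]%N.

Definition W_le : rel W_type := fun x y => (x == y) || W_lt x y.

Fact W_lt_def (x y : W_type) : W_lt x y = (y != x) && W_le x y.
Proof.
by case: x => [[|[|[|[|[|//]]]]] ?]; case: y => [[|[|[|[|[|//]]]]] ?].
Qed.

Fact W_le_refl : reflexive W_le.
Proof. by move=> x; rewrite /W_le eqxx. Qed.

Fact W_le_anti : antisymmetric W_le.
Proof.
move=> x y h; apply/val_inj; move: h.
by case: x => [[|[|[|[|[|//]]]]] ?]; case: y => [[|[|[|[|[|//]]]]] ?].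
Qed.

Fact W_le_trans : transitive W_le.
Proof.
move=> y x z; case: x => [[|[|[|[|[|//]]]]] ?];
  by case: y => [[|[|[|[|[|//]]]]] ?]; case: z => [[|[|[|[|[|//]]]]] ?].
Qed.

HB.instance Definition _ := Finite.on W_type.
HB.instance Definition _ := @Order.isPOrder.Build (Order.Disp tt tt) W_type
  W_le W_lt W_lt_def W_le_refl W_le_anti W_le_trans.

Definition poset_W : finPoset := FinPoset (W_type : finPOrderType _).
Definition poset_M : finPoset := FinPoset (W_type^d : finPOrderType _).

Definition family_WM : posetFamily := fun P => P = poset_W \/ P = poset_M.

(* Main.v *)
(** A family is P_6-free exactly when its comparability graph has no path on six
vertices, because any six sets that are consecutively comparable contain the
zigzag poset given by the directions of the steps; and each of the 32 zigzags on
six elements contains W or M. The lower bound is the middle level together with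
the empty set and the full set.

For the upper bound, the Erdős–Gallai argument gives at most [2 |F|] comparable
pairs, so it remains to see that [|F| <= (1 + o(1)) C(n, n/2)]. Discard the
sets of size below [K] or above [n - K], which number [O(K^2 / n) C(n, n/2)].
On a random maximal chain the expected number of members of [F] exceeds 1 by at
most the expected number of comparable pairs. A pair [A < B] is met with
probability at most [1/K] times that of meeting [A], and likewise for [B]; as
the graph is 4-degenerate, the expected number of pairs is therefore at most
[4/K] times the expected number of members. *)

Require Import Defs.
From HB Require Import structures.
From mathcomp Require Import all_boot all_order all_algebra.
From mathcomp Require Import all_classical all_reals all_analysis.
From mathcomp Require Import zify ring lra.

Set Implicit Arguments.
Unset Strict Implicit.
Unset Printing Implicit Defensive.

Import Order.TTheory GRing.Theory Num.Theory.
Import numFieldNormedType.Exports.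

Local Open Scope classical_set_scope.
Local Open Scope ring_scope.

(** * Graphs without a path on six vertices *)

Definition no_path (T : finType) (e : rel T) (k : nat) (S : {set T}) : Prop :=
  forall p : seq T, {subset p <= S} -> sorted e p -> uniq p -> (size p < k)%N.

Definition nbhd (T : finType) (e : rel T) (S : {set T}) (x : T) : {set T} :=
  [set y in S | e x y]%SET.

Lemma no_pathS (T : finType) (e : rel T) k (S S' : {set T}) :
  S' \subset S -> no_path e k S -> no_path e k S'.
Proof. by move=> /fintype.subsetP sS' nS p pS'; apply: nS => x /pS'/sS'. Qed.

(** A neighbour of the endpoint [x] lying off the path could be prepended, giving a path that is too
    long; so all neighbours of [x] are on it. *)
Lemma max_path_end (T : finType) (e : rel T) (S : {set T}) (x : T) (p : seq T) :
  symmetric e -> irreflexive e -> no_path e (size p).+2 S ->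
  {subset x :: p <= S} -> sorted e (x :: p) -> uniq (x :: p) ->
  (#|nbhd e S x| <= count (e x) p)%N.
Proof.
move=> esym eirr nS pS ep up; rewrite -size_filter.
apply: leq_trans (card_size _); apply: subset_leq_card.
apply/fintype.subsetP => y; rewrite inE => /andP[yS exy].
rewrite mem_filter exy /=; apply/negPn/negP => yp.
have yx : y != x by apply: contraTneq exy => ->; rewrite eirr.
suff: (size [:: y, x & p] < (size p).+2)%N by rewrite /= ltnn.
apply: nS.
- by move=> z; rewrite inE => /predU1P[->//|]; apply: pS.
- by rewrite /= esym exy.
- by rewrite cons_uniq inE negb_or yx yp.
Qed.

(** Opening the cycle at [x] and prepending an outside neighbour [y] would give a path with one
    vertex too many. *)
Lemma max_cycle_closed (T : finType) (e : rel T) (S : {set T}) (c : seq T) :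
  symmetric e -> no_path e (size c).+1 S ->
  {subset c <= S} -> cycle e c -> uniq c ->
  forall x y, x \in c -> y \in S -> e x y -> y \in c.
Proof.
move=> esym nS cS ec uc x y xc yS exy; apply/negPn/negP => yc.
have [i s def_s] := rot_to xc.
have es : sorted e (x :: s).
  by move: ec; rewrite -(rot_cycle i) def_s /= rcons_path => /andP[].
have mem_s : x :: s =i c by move=> z; rewrite -def_s mem_rot.
suff: (size [:: y, x & s] < (size c).+1)%N.
  by rewrite -(size_rot i c) def_s /= ltnn.
apply: nS.
- by move=> z; rewrite inE mem_s => /predU1P[->//|]; apply: cS.
- by rewrite /= esym exy.
- by rewrite cons_uniq mem_s yc -def_s rot_uniq.
Qed.

(* If all degrees exceed 2, the endpoints of a longest path (at most 5
   vertices) have enough neighbours on it to close it up into a cycle, and by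
   maximality no edge leaves that cycle. *)
Lemma no_path6_reducible (T : finType) (e : rel T) (S : {set T}) :
  symmetric e -> irreflexive e -> S != finset.set0 -> no_path e 6 S ->
  (exists2 x, x \in S & (#|nbhd e S x| <= 2)%N) \/
  (exists C : {set T}, [/\ C \subset S, C != finset.set0, (#|C| <= 5)%N &
     forall x y, x \in C -> y \in S -> e x y -> y \in C]).
Proof.
move=> esym eirr S0 nS.
have [/exists_inP[x xS dx]|] := boolP [exists x in S, #|nbhd e S x| <= 2]%N.
  by left; exists x.
rewrite negb_exists_in => /forall_inP degS; right.
have {}degS x : x \in S -> (2 < #|nbhd e S x|)%N.
  by move=> /degS; rewrite -ltnNge.
(* [P m] says that [S] contains a path on [m] vertices; [p] below is a longest one. *)
pose P m := [exists p : m.-tuple T, [&& all (mem S) p, sorted e p & uniq p]].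
have [x0 x0S] := set0Pn _ S0.
have exP : exists m, P m.
  by exists 1%N; apply/existsP; exists [tuple x0]; rewrite /= x0S.
have ubP m : P m -> (m <= 5)%N.
  move=> /existsP[p /and3P[/allP pS ep up]].
  by rewrite -ltnS -[m](size_tuple p); apply: nS.
case: (ex_maxnP exP ubP) => k /existsP[[p sz_p] /= /and3P[pS ep up]] maxk.
have {maxk} nSk : no_path e k.+1 S.
  move=> q qS eq uq; rewrite ltnS; apply: maxk; apply/existsP.
  exists (in_tuple q); rewrite /= eq uq !andbT; exact/allP.
have kle : (k <= 5)%N.
  by rewrite -ltnS -(eqP sz_p); apply: nS => //; apply/allP.
have front x q : p = x :: q -> (2 < count (e x) q)%N.
  move=> def_p; rewrite def_p in pS ep up sz_p.
  apply: leq_trans (max_path_end (S := S) esym eirr _ _ ep up).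
  - by apply: degS; move: pS => /= /andP[].
  - by move: nSk; rewrite -(eqP sz_p).
  - exact/allP.
have back x q : rev p = x :: q -> (2 < count (e x) q)%N.
  move=> def_p; have epr : sorted e (x :: q).
    by rewrite -def_p rev_sorted; move: ep; apply: sub_sorted => a b; rewrite /= esym.
  have upr : uniq (x :: q) by rewrite -def_p rev_uniq.
  have pSr : all (mem S) (x :: q) by rewrite -def_p all_rev.
  apply: leq_trans (max_path_end (S := S) esym eirr _ _ epr upr).
  - by apply: degS; move: pSr => /= /andP[].
  - by move: nSk; rewrite -(eqP sz_p) -size_rev def_p.
  - exact/allP.
(* It suffices to rearrange the vertices of [p] into a cycle: by [max_cycle_closed] no edge of [S]
   leaves its vertex set. *)
suff [c pc ec] : exists2 c, perm_eq c p & cycle e c.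
  have sz_c : size c = k by rewrite (perm_size pc) (eqP sz_p).
  have cS : {subset c <= S} by move=> x; rewrite (perm_mem pc) => /(allP pS).
  have k0 : (0 < k)%N.
    case: (k) sz_p nSk => // _ /(_ [:: x0])-/(_ _ isT isT); apply=> z.
    by rewrite inE => /eqP->.
  exists [set x in c]%SET; split.
  - by apply/fintype.subsetP => x; rewrite inE => /cS.
  - case: c {pc ec cS} sz_c k0 => [<-//|a c _ _].
    by apply/set0Pn; exists a; rewrite !inE eqxx.
  - by rewrite cardsE (leq_trans (card_size _))// sz_c.
  - move=> x y; rewrite !inE; apply: max_cycle_closed => //; first by rewrite sz_c.
    by rewrite (perm_uniq pc).
have {}kle : (size p <= 5)%N by rewrite (eqP sz_p).
case: p kle front back ep {up nSk degS pS sz_p}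
  => [|x1 [|x2 [|x3 [|x4 [|x5 [|//]]]]]] _ front back ep.
- by exists [::].
- by have := front _ _ erefl.
- by have := front _ _ erefl; rewrite /=; case: (e x1 x2).
- by have := front _ _ erefl; rewrite /=; case: (e x1 x2); case: (e x1 x3).
- have := front _ _ erefl; move: ep => /= /and4P[e12 e23 e34 _].
  case: (e x1 x3); case e14 : (e x1 x4); rewrite e12 // => _.
  by exists [:: x1; x2; x3; x4]; rewrite //= e12 e23 e34 esym e14.
- have := front _ _ erefl; have := back _ _ erefl.
  move: ep => /= /and5P[e12 e23 e34 e45 _].
  rewrite (esym x5 x4) (esym x5 x3) (esym x5 x2) (esym x5 x1) e12 e45.
  case e15 : (e x1 x5).
    by exists [:: x1; x2; x3; x4; x5]; rewrite //= e12 e23 e34 e45 esym e15.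
  case e25: (e x2 x5); case e35: (e x3 x5) => //= _.
  case e13: (e x1 x3); case e14: (e x1 x4) => //= _.
  (* Without the edge [x1 x5], both ends are adjacent to all of [x2], [x3], [x4], and
     [x1 x2 x5 x4 x3] is a cycle. *)
  exists [:: x1, x2 & rev [:: x3; x4; x5]]; first by rewrite !perm_cons perm_rev.
  by rewrite /= e12 e25 esym e45 esym e34 esym e13.
Qed.

(** * Weighted edge sums and their bounds *)

(** The sum runs over ordered pairs, so every edge counts twice; this is the source of the doubled
    constants below. *)
Definition edge_sum (T : finType) (V : nmodType) (e : rel T) (g : T -> T -> V)
    (S : {set T}) : V := \sum_(x in S) \sum_(y in S | e x y) g x y.

Lemma edge_sumD1 (T : finType) (V : nmodType) (e : rel T) (g : T -> T -> V)
    (S : {set T}) (x : T) :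
  symmetric e -> irreflexive e -> (forall y z, g y z = g z y) -> x \in S ->
  edge_sum e g S =
  edge_sum e g (S :\ x)%SET + (\sum_(y in S | e x y) g x y) *+ 2.
Proof.
move=> esym eirr gsym xS; rewrite /edge_sum (big_setD1 x)//= mulr2n.
have -> : \sum_(y in (S :\ x)%SET) \sum_(z in S | e y z) g y z =
    \sum_(y in (S :\ x)%SET) (\sum_(z in (S :\ x)%SET | e y z) g y z +
      (if e x y then g x y else 0)).
  apply: eq_bigr => y ySx; rewrite big_mkcondr (big_setD1 x)//= addrC.
  by rewrite -big_mkcondr esym gsym.
rewrite big_split /= addrCA; congr (_ + (_ + _)).
by rewrite -big_mkcondr [RHS]big_mkcondr [RHS](big_setD1 x)//= eirr add0r -big_mkcondr.
Qed.

Lemma edge_sum_closed (T : finType) (V : nmodType) (e : rel T) (g : T -> T -> V)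
    (S C : {set T}) :
  symmetric e -> C \subset S ->
  (forall x y, x \in C -> y \in S -> e x y -> y \in C) ->
  edge_sum e g S = edge_sum e g C + edge_sum e g (S :\: C)%SET.
Proof.
move=> esym CS closed; rewrite /edge_sum (big_setID C) /= (finset.setIidPr CS).
have sCS := fintype.subsetP CS.
congr (_ + _); apply: eq_bigr => x; rewrite ?inE => xC; apply: eq_bigl => y.
  apply/andP/andP => -[yS exy]; split=> //; [exact: closed yS exy|exact: sCS].
rewrite inE; case: (boolP (y \in S)) => yS //=; last by rewrite andbF.
case: (boolP (y \in C)) => //= yC; apply/negbTE/negP => exy.
case/andP: xC => /negP xNC xS; apply: xNC; rewrite esym in exy.
exact: closed exy.
Qed.

Lemma edge_sum1 (T : finType) (R : pzSemiRingType) (e : rel T) (S : {set T}) :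
  edge_sum e (fun _ _ => 1) S = (\sum_(x in S) #|nbhd e S x|)%:R :> R.
Proof.
rewrite natr_sum; apply: eq_bigr => x _; rewrite sumr_const; congr (_ *+ _).
by apply: eq_card => y; rewrite !inE.
Qed.

(** Induction on the size of [S]. Removing a vertex of degree at most 2 lowers the doubled sum by at
    most 4; removing a closed set of [c <= 5] vertices lowers it by at most
    [c * (c - 1) <= 4 * c]. *)
Lemma Erdos_Gallai_6 (T : finType) (R : numDomainType) (e : rel T) (S : {set T}) :
  symmetric e -> irreflexive e -> no_path e 6 S ->
  edge_sum e (fun _ _ => 1) S <= 4 * #|S|%:R :> R.
Proof.
move=> esym eirr; have [m] := ubnP #|S|; elim: m S => // m IHm S ltSm nS.
have [->|S0] := eqVneq S finset.set0.
  by rewrite /edge_sum big_set0 cards0 mulr0.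
have [[x xS dx]|[C [CS C0 szC closed]]] := no_path6_reducible esym eirr S0 nS.
  rewrite (edge_sumD1 _ _ _ xS) // (cardsD1 x) xS natrD mulrDr mulr1 addrC.
  apply: lerD; last first.
    apply: IHm; first by move: ltSm; rewrite (cardsD1 x) xS.
    exact: no_pathS (finset.subsetDl _ _) nS.
  rewrite sumr_const -[_ *+ 2]mulrnA ler_nat.
  rewrite -[4%N]/(2 * 2)%N leq_mul2r (leq_trans _ dx) //.
  by apply/eq_leq/eq_card => y; rewrite !inE.
rewrite (edge_sum_closed _ esym CS closed) -(cardsID C S) (finset.setIidPr CS).
rewrite natrD mulrDr; apply: lerD; last first.
  apply: IHm; last exact: no_pathS (finset.subsetDl _ _) nS.
  move: C0 ltSm; rewrite -card_gt0 -(cardsID C S) (finset.setIidPr CS); lia.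
rewrite edge_sum1 -natrM ler_nat mulnC -sum_nat_const leq_sum // => x xC.
have : (#|nbhd e C x| <= #|C :\ x|%SET)%N.
  apply: subset_leq_card; apply/fintype.subsetP => y; rewrite !inE => /andP[-> exy].
  by rewrite andbT; apply: contraTneq exy => ->; rewrite eirr.
by move: szC; rewrite (cardsD1 x C) xC; lia.
Qed.

(** A vertex of a closed set with at most 5 elements has all its neighbours among the other 4. *)
Lemma no_path6_min_degree (T : finType) (e : rel T) (S : {set T}) :
  symmetric e -> irreflexive e -> S != finset.set0 -> no_path e 6 S ->
  exists2 x, x \in S & (#|nbhd e S x| <= 4)%N.
Proof.
move=> esym eirr S0 nS.
have [[x xS dx]|[C [CS /set0Pn[x xC] szC closed]]] :=
  no_path6_reducible esym eirr S0 nS; exists x => //.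
- exact: leq_trans dx _.
- exact: (fintype.subsetP CS).
have : (#|nbhd e S x| <= #|C :\ x|%SET)%N.
  apply: subset_leq_card; apply/fintype.subsetP => y; rewrite !inE => /andP[yS exy].
  rewrite (closed x) // andbT; apply: contraTneq exy => ->; rewrite eirr //.
by move: szC; rewrite (cardsD1 x C) xC; lia.
Qed.

(* Remove vertices of degree at most 4 one at a time, charging each deleted
   edge to the removed endpoint. *)
Lemma edge_sum_no_path6 (T : finType) (R : numDomainType) (e : rel T)
    (g : T -> T -> R) (h : T -> R) (S : {set T}) :
  symmetric e -> irreflexive e -> (forall x y, g x y = g y x) ->
  (forall x, x \in S -> 0 <= h x) ->
  (forall x y, x \in S -> y \in S -> e x y -> g x y <= h x) ->
  no_path e 6 S -> edge_sum e g S <= 8 * \sum_(x in S) h x.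
Proof.
move=> esym eirr gsym.
have [m] := ubnP #|S|; elim: m S => // m IHm S ltSm h0 gh nS.
have [->|S0] := eqVneq S finset.set0.
  by rewrite /edge_sum !big_set0 mulr0.
have [x xS dx] := no_path6_min_degree esym eirr S0 nS.
have subS : (S :\ x \subset S)%SET by exact: finset.subsetDl.
rewrite (edge_sumD1 _ _ _ xS) // [X in _ <= _ * X](big_setD1 x) //= mulrDr addrC.
apply: lerD; last first.
  apply: IHm.
  - by move: ltSm; rewrite (cardsD1 x) xS.
  - by move=> y /(fintype.subsetP subS); apply: h0.
  - by move=> y z /(fintype.subsetP subS) yS /(fintype.subsetP subS); apply: gh.
  - exact: no_pathS subS nS.
apply: (@le_trans _ _ ((\sum_(y in S | e x y) h x) *+ 2)).
  by rewrite lerMn2r ler_sum // => y /andP[yS exy]; apply: gh.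
rewrite sumr_const -[_ *+ 2]mulrnA mulr_natl; apply: ler_wpMn2l; first exact: h0.
rewrite -[8%N]/(4 * 2)%N leq_mul2r (leq_trans _ dx) //.
by apply/eq_leq/eq_card => y; rewrite !inE.
Qed.

(** * Binomial estimates *)

Lemma leq_bin_self a b : (0 < a < b)%N -> (b <= 'C(b, a))%N.
Proof.
elim: b a => // b IHb [//|a]; rewrite ltnS => /andP[_ ab].
have [->|ne] := eqVneq a.+1 b; first by rewrite binSn.
rewrite binS -addn1; apply: leq_add; last by rewrite bin_gt0 ltnW.
by apply: IHb; rewrite ltn0Sn ltn_neqAle ne.
Qed.

(** Both sides count the nested pairs of subsets of sizes [a] and [b] in an [n]-set; the proof
    cancels factorials. *)
Lemma mul_bin_trans a b n : (a <= b)%N -> (b <= n)%N ->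
  ('C(n, b) * 'C(b, a) = 'C(n, a) * 'C(n - a, b - a))%N.
Proof.
move=> ab bn; have an := leq_trans ab bn.
have := bin_fact ab; have := bin_fact bn; have := bin_fact an.
have := bin_fact (leq_sub2r a bn).
have -> : (n - a - (b - a) = n - b)%N by lia.
move=> E1 E2 E3 E4.
have : (0 < a`! * (b - a)`! * (n - b)`!)%N by rewrite !muln_gt0 !fact_gt0.
move=> pos; apply/eqP; rewrite -(eqn_pmul2r pos); apply/eqP.
transitivity (n`!)%N; [rewrite -E3 -E4|rewrite -E2 -E1]; ring.
Qed.

Lemma leq_bin_half j k n : (j <= k <= n./2)%N -> ('C(n, j) <= 'C(n, k))%N.
Proof.
move=> /andP[/subnK <-]; elim: (k - j)%N => // i IHi le_n.
apply: leq_trans (IHi (ltnW le_n)) _; rewrite -[(i.+1 + j)%N]/(i + j).+1.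
rewrite -(leq_pmul2l (ltn0Sn (i + j))) mul_bin_left leq_mul2r.
by apply/orP; right; move: le_n; lia.
Qed.

Lemma leq_bin_mid k n : ('C(n, k) <= 'C(n, n./2))%N.
Proof.
have [le_k|lt_k] := leqP k n./2; first by rewrite leq_bin_half // le_k leqnn.
have [le_kn|/bin_small->//] := leqP k n.
by rewrite -bin_sub // leq_bin_half // leqnn andbT; move: lt_k; lia.
Qed.

(** * Random maximal chains and a LYM-type inequality *)

Section LYM.
Variables (R : realFieldType) (T : finType).
Implicit Types (A B : {set T}) (F : {set {set T}}).

(* The probability that a uniformly random maximal chain from the empty set to
   [B] passes through the subset [A]. *)
Definition hit A B : R := ('C(#|B|, #|A|)%:R)^-1.

(** The expected number of members of [F] strictly below [B] on a random maximal chain up to [B]. *)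
Definition hits_below F B : R := \sum_(A in F | A \proper B) hit A B.

Lemma hit_ge0 A B : 0 <= hit A B.
Proof. by rewrite invr_ge0 ler0n. Qed.

(** Total probability: just below [B] the chain passes through [B :\ x] for a uniformly random [x],
    and its lower part is a random chain up to that set. *)
Lemma hit_average A B : A \proper B ->
  \sum_(x in B | A \subset (B :\ x)%SET) hit A (B :\ x)%SET = #|B|%:R * hit A B.
Proof.
move=> AB; have [AsB ltAB] := (proper_sub AB, proper_card AB).
have cB x : x \in B -> #|(B :\ x)%SET| = #|B|.-1.
  by move=> xB; rewrite [in RHS](cardsD1 x) xB.
rewrite (eq_bigr (fun=> ('C(#|B|.-1, #|A|)%:R)^-1)); last first.
  by move=> x /andP[xB _]; rewrite /hit cB.
rewrite sumr_const.
have -> : #|[pred x in B | A \subset (B :\ x)%SET]| = (#|B| - #|A|)%N.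
  rewrite -(cardsDS AsB); apply: eq_card => x.
  by rewrite !inE finset.subsetD1 AsB andbC.
have := mul_bin_down #|B| #|A| => /(congr1 (fun m => m%:R : R)).
rewrite !natrM => E; rewrite /hit -[LHS]mulr_natl.
have c1 : 'C(#|B|, #|A|)%:R != 0 :> R by rewrite pnatr_eq0 -lt0n bin_gt0 ltnW.
have c2 : 'C(#|B|.-1, #|A|)%:R != 0 :> R.
  by rewrite pnatr_eq0 -lt0n bin_gt0 -ltnS prednK // (leq_ltn_trans _ ltAB).
by apply: (mulIf c1); rewrite mulfVK // mulrAC -E mulfK.
Qed.

(** If a random chain up to [B] meets [F] in [N] sets, the left side is the expectation of
    [N - N * (N - 1) / 2], which never exceeds 1. The formal proof is an induction on [#|B|]. *)
Lemma LYM_chains F B :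
  \sum_(A in F | A \subset B) hit A B * (1 - hits_below F A) <= 1.
Proof.
have [m] := ubnP #|B|; elim: m B => // m IHm B ltBm.
have z_le1 A : 1 - hits_below F A <= 1.
  by rewrite gerBl sumr_ge0 // => ? _; apply: hit_ge0.
have [BF|BNF] := boolP (B \in F).
  (* The term of [B] itself is [1 - hits_below F B], and the other terms add at most
     [hits_below F B]. *)
  rewrite (bigD1 B) ?BF ?fintype.subxx //= {1}/hit binn invr1 mul1r.
  rewrite -[leRHS](subrK (hits_below F B)) lerD2l {2}/hits_below.
  rewrite (eq_bigl (fun A => (A \in F) && (A \proper B))); last first.
    by move=> A /=; rewrite finset.properEneq -andbA [(A != B) && _]andbC.
  by apply: ler_sum => A _; rewrite ler_piMr ?hit_ge0.
have [B0|B0] := eqVneq #|B| 0%N.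
  rewrite big_pred0 // => A; apply/negbTE/negP => /andP[AF].
  move/cards0_eq: B0 => B0; rewrite B0 finset.subset0 => /eqP A0.
  by rewrite B0 -A0 AF in BNF.
have Bgt0 : 0 < #|B|%:R :> R by rewrite ltr0n lt0n.
rewrite -(ler_pM2l Bgt0) mulr1 mulr_sumr.
(* When [B] is not in [F], the sum is the average over [x] of the sums for [B :\ x], to which
   induction applies. *)
have -> : \sum_(A in F | A \subset B) #|B|%:R * (hit A B * (1 - hits_below F A)) =
    \sum_(x in B) \sum_(A in F | A \subset (B :\ x)%SET)
      hit A (B :\ x)%SET * (1 - hits_below F A).
  rewrite (exchange_big_dep (fun A => (A \in F) && (A \subset B))) /=; last first.
    by move=> x A _ /andP[-> /fintype.subset_trans->//]; exact: finset.subsetDl.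
  apply: eq_bigr => A /andP[AF AB]; rewrite mulrA -hit_average; last first.
    by rewrite finset.properEneq AB andbT; apply: contraNneq BNF => <-.
  rewrite mulr_suml; apply: eq_bigl => x; rewrite AF //.
rewrite -[leRHS]sumr_const; apply: ler_sum => x xB; apply: IHm.
by move: ltBm; rewrite (cardsD1 x) xB.
Qed.

End LYM.

(** * Families of medium-sized sets *)

Lemma edge_sum_oriented (T : finType) (V : nmodType) (r : rel T)
    (f : T -> T -> V) (S : {set T}) :
  edge_sum (fun x y => r x y || r y x)
    (fun x y => (if r x y then f x y else 0) + (if r y x then f y x else 0)) S =
  (\sum_(x in S) \sum_(y in S | r x y) f x y) *+ 2.
Proof.
rewrite /edge_sum.
transitivity (\sum_(x in S) \sum_(y in S)
    ((if r x y then f x y else 0) + (if r y x then f y x else 0))).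
  apply: eq_bigr => x _; rewrite big_mkcondr; apply: eq_bigr => y _.
  by case: (r x y); case: (r y x); rewrite //= addr0.
under eq_bigr do rewrite big_split.
rewrite big_split mulr2n /=; congr (_ + _); last rewrite exchange_big /=;
  by apply: eq_bigr => x _; rewrite [RHS]big_mkcondr.
Qed.

Definition inclusion_comparable (T : finType) : rel {set T} :=
  fun A B => (A \proper B) || (B \proper A).

Lemma inclusion_comparable_sym (T : finType) :
  symmetric (@inclusion_comparable T).
Proof. by move=> A B; rewrite /inclusion_comparable orbC. Qed.

Lemma inclusion_comparable_irr (T : finType) :
  irreflexive (@inclusion_comparable T).
Proof. by move=> A; rewrite /inclusion_comparable fintype.properxx. Qed.

(** Both sides are the probability that a random full chain meets [A] and [B]: the left conditions
    on [B], the right on [A]. *)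
Lemma hit_trans (R : realFieldType) (T : finType) (A B : {set T}) :
  A \subset B ->
  hit R B finset.setT * hit R A B =
  hit R A finset.setT * ('C(#|T| - #|A|, #|B| - #|A|)%:R)^-1.
Proof.
move=> AB; rewrite /hit !cardsT -!invfM -!natrM mul_bin_trans //.
  exact: subset_leq_card.
exact: max_card.
Qed.

Lemma LYM_no_path6 (R : realFieldType) (T : finType) (K : nat)
    (F : {set {set T}}) :
  (0 < K)%N -> (forall A, A \in F -> (K <= #|A|)%N /\ (#|A| + K <= #|T|)%N) ->
  no_path (@inclusion_comparable T) 6 F ->
  (1 - 4 / K%:R) * \sum_(A in F) hit R A finset.setT <= 1.
Proof.
move=> K0 midF nF; pose w (A : {set T}) := hit R A finset.setT.
have w0 A : 0 <= w A by apply: hit_ge0.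
have K0R : 0 < K%:R :> R by rewrite ltr0n.
have invK m : (K <= m)%N -> (m%:R)^-1 <= (K%:R)^-1 :> R.
  by move=> Km; rewrite lef_pV2 ?posrE ?ltr0n ?ler_nat // (leq_trans K0).
(* Given one of the two sets, the other is met with probability the inverse of a binomial
   coefficient, which [leq_bin_self] shows to be at least [K]; [0 < K] keeps [A] nonempty and [B]
   different from the ground set. *)
have gle A B : A \in F -> B \in F -> A \proper B ->
    (w B * hit R A B <= w A / K%:R) /\ (w B * hit R A B <= w B / K%:R).
  move=> AF BF AB; have ltAB := proper_card AB.
  have [KA AK] := midF _ AF; have [KB BK] := midF _ BF; split; last first.
    apply: ler_wpM2l => //; apply: invK; apply: leq_trans KB _.
    by apply: leq_bin_self; rewrite ltAB andbT; apply: leq_trans KA.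
  rewrite /w (hit_trans R (proper_sub AB)); apply: ler_wpM2l; first exact: w0.
  apply: invK.
  apply: (@leq_trans (#|T| - #|A|)); first by lia.
  by apply: leq_bin_self; lia.
pose f (A B : {set T}) := w B * hit R A B.
pose g (A B : {set T}) := (if A \proper B then f A B else 0) +
                          (if B \proper A then f B A else 0).
have := edge_sum_no_path6 (g := g) (h := fun A => w A / K%:R)
  (@inclusion_comparable_sym T) (@inclusion_comparable_irr T) _ _ _ nF.
rewrite /inclusion_comparable /g edge_sum_oriented -mulr_suml => bnd.
have {bnd} : \sum_(A in F) \sum_(B in F | A \proper B) f A B
    <= 4 * ((\sum_(A in F) w A) / K%:R).
  suff : (\sum_(A in F) \sum_(B in F | A \proper B) f A B) *+ 2
      <= 8 * ((\sum_(A in F) w A) / K%:R) by lra.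
  apply: bnd => [A B|A AF|A B AF BF].
  - by rewrite addrC.
  - by rewrite divr_ge0 // ltW.
  case: ifP => [AB|_ /= BA].
    have /negbTE -> : ~~ (B \proper A).
      by apply/negP => /(fintype.proper_trans AB); rewrite fintype.properxx.
    by rewrite addr0 => _; case: (gle A B AF BF AB).
  by rewrite BA add0r; case: (gle B A BF AF BA).
(* Grouping the pairs by their larger set yields the correction term of [LYM_chains]. *)
have -> : \sum_(A in F) \sum_(B in F | A \proper B) f A B =
    \sum_(A in F) w A * hits_below R F A.
  rewrite (exchange_big_dep (mem F)) /=; last by move=> A B _ /andP[].
  by apply: eq_bigr => B BF; rewrite mulr_sumr; apply: eq_bigl => A; rewrite BF.
have := LYM_chains R F finset.setT.
rewrite (eq_bigl (mem F)); last by move=> A /=; rewrite finset.subsetT andbT.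
under eq_bigr do rewrite mulrBr mulr1 -/(w _).
by rewrite sumrB mulrBl mul1r mulrAC -mulrA => *; lra.
Qed.

(** Every set lies on a random full chain with probability at least the inverse of the middle
    binomial coefficient; [4 < K] keeps the factor [1 - 4 / K] from being negative. *)
Lemma card_no_path6 (R : realFieldType) n (K : nat) (F : {set {set 'I_n}}) :
  (4 < K)%N -> (forall A, A \in F -> (K <= #|A|)%N /\ (#|A| + K <= n)%N) ->
  no_path (@inclusion_comparable 'I_n) 6 F ->
  (1 - 4 / K%:R) * #|F|%:R <= 'C(n, n./2)%:R :> R.
Proof.
move=> K4 midF nF; have K0 : (0 < K)%N by apply: leq_ltn_trans K4.
have c0 : 0 < 'C(n, n./2)%:R :> R by rewrite ltr0n bin_gt0; lia.
have pos : 0 <= 1 - 4 / K%:R :> R.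
  by rewrite subr_ge0 ler_pdivrMr ?ltr0n // mul1r ler_nat ltnW.
rewrite -[leRHS]mul1r -ler_pdivrMr // -mulrA.
apply: le_trans (LYM_no_path6 R K0 _ nF); last by move=> A /midF; rewrite card_ord.
apply: ler_wpM2l => //; rewrite mulr_natl -sumr_const; apply: ler_sum => A _.
have An : (#|A| <= n)%N by rewrite -[leqRHS]card_ord max_card.
rewrite /hit cardsT card_ord lef_pV2 ?posrE ?ler_nat ?leq_bin_mid //.
by rewrite ltr0n bin_gt0.
Qed.

(** * Sets of extreme size *)

(** For [K > 0], each of the [K] levels has at most ['C(n, K - 1)] sets, and ['C(n, K - 1) * (n - K
    + 1) = K * 'C(n, K)]. *)
Lemma card_small_sets n K : (K.*2 <= n)%N ->
  (#|[set A : {set 'I_n} | #|A| < K]%SET| * (n - K).+1 <= K * K * 'C(n, n./2))%N.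
Proof.
case: K => [|K] Kn.
  by rewrite eq_card0 // => A; rewrite inE ltn0.
have card_le : (#|[set A : {set 'I_n} | #|A| < K.+1]%SET| <= K.+1 * 'C(n, K))%N.
  pose level (A : {set 'I_n}) : 'I_K.+1 := inord #|A|.
  rewrite -sum1_card (partition_big level predT) //=.
  rewrite -[X in (_ <= X * _)%N]card_ord -sum_nat_const; apply: leq_sum => k _.
  apply: (@leq_trans 'C(n, k)); last first.
    by rewrite leq_bin_half //; have := ltn_ord k; lia.
  rewrite sum1_card -[X in 'C(X, _)](card_ord n) -card_draws; apply: subset_leq_card.
  apply/fintype.subsetP => A; rewrite [in X in _ -> X]inE.
  by rewrite unfold_in => /andP[+ /eqP <-]; rewrite inE => ltA; rewrite inordK.
apply: leq_trans (leq_mul card_le (leqnn _)) _.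
have -> : (n - K.+1).+1 = (n - K)%N by lia.
rewrite -mulnA [('C(_, _) * _)%N]mulnC -mul_bin_left mulnA leq_mul2l.
by rewrite leq_bin_mid orbT.
Qed.

Lemma card_extreme_sets n K : (K.*2 <= n)%N ->
  (#|[set A : {set 'I_n} | (#|A| < K) || (n < #|A| + K)]%SET| * (n - K).+1
    <= 2 * (K * K * 'C(n, n./2)))%N.
Proof.
move=> Kn; set L := [set A : {set 'I_n} | (#|A| < K)%N]%SET.
(* Complementation turns the large sets into the small ones. *)
have -> : [set A : {set 'I_n} | (#|A| < K)%N || (n < #|A| + K)%N]%SET =
    (L :|: (@finset.setC _) @: L)%SET.
  apply/setP => A; rewrite !inE; congr (_ || _).
  have cA : (#|A| + #|~: A|%SET = n)%N by rewrite cardsC card_ord.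
  apply/idP/imsetP => [nA|[B]].
    by exists (~: A)%SET; rewrite ?finset.setCK // inE; lia.
  by rewrite inE => + AB; move: cA; rewrite AB finset.setCK; lia.
apply: (@leq_trans ((#|L| + #|L|) * (n - K).+1)).
  rewrite leq_mul2r; apply/orP; right; apply: leq_trans (leq_card_setU _ _) _.
  by rewrite leq_add2l leq_imset_card.
by rewrite mulnDl mul2n -addnn leq_add // card_small_sets.
Qed.

(** * Zigzag posets on six elements *)

(** A list enumeration that [vm_compute] can evaluate, both for the 32 direction words and for
    candidate embeddings into six elements. *)
Fixpoint words (T : Type) (k : nat) (s : seq T) : seq (seq T) :=
  if k is k'.+1 then [seq x :: w | x <- s, w <- words k' s] else [:: [::]].

Lemma mem_words (T : eqType) k (s w : seq T) :
  (w \in words k s) = (size w == k) && all (mem s) w.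
Proof.
elim: k w => [|k IHk] [|x w] //=.
  by apply/negbTE/negP => /allpairsP[[y v] /= [_ _]].
apply/allpairsP/and3P => [[[y v] /= [ys vs [-> ->]]]|[sz xs ws]].
  by move: vs; rewrite IHk => /andP[/eqP-> ->]; rewrite eqxx.
by exists (x, w); rewrite xs IHk -eqSS sz.
Qed.

(* The order on indices generated by [i < i.+1] when bit [i] is set and
   [i.+1 < i] when it is not. *)
Definition zigzag_lt (b : seq bool) (i j : nat) : bool :=
  if (i < j)%N then all id (take (j - i) (drop i b))
  else (j < i)%N && all negb (take (i - j) (drop j b)).

(** Exhaustive check of transitivity, needed for the order instance, and of the Hasse diagram being
    the path [0, ..., 5]. *)
Lemma zigzag_lt_check :
  all (fun b => let lt := zigzag_lt b in let I := iota 0 6 in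
    all (fun i => all (fun j =>
      all (fun k => lt i j && lt j k ==> lt i k) I &&
      (((lt i j && ~~ has (fun k => lt i k && lt k j) I) ||
        (lt j i && ~~ has (fun k => lt j k && lt k i) I)) ==
       ((i.+1 == j) || (j.+1 == i)))) I) I)
    (words 5 [:: true; false]).
Proof. by vm_compute. Qed.

(** The word [g] lists the images of [a] to [e]; the first alternative places [W], the second
    [M]. *)
Lemma zigzag_WM_check :
  all (fun b => let lt := zigzag_lt b in
    has (fun g => let v := nth 0%N g in uniq g &&
      ([&& lt (v 1) (v 0), lt (v 1) (v 2), lt (v 3) (v 2) & lt (v 3) (v 4)] ||
       [&& lt (v 0) (v 1), lt (v 2) (v 1), lt (v 2) (v 3) & lt (v 4) (v 3)])%N)
    (words 5 (iota 0 6)))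
  (words 5 [:: true; false]).
Proof. by vm_compute. Qed.

Lemma mem_bits (b : 5.-tuple bool) : (b : seq bool) \in words 5 [:: true; false].
Proof. by rewrite mem_words size_tuple; apply/allP => -[]. Qed.

(** Carrying [b] in the type lets each direction word have its own canonical order on ['I_6]. *)
Definition zigzag (b : 5.-tuple bool) : Type := 'I_6.

Section ZigzagOrder.
Variable b : 5.-tuple bool.

Let lt_zigzag : rel (zigzag b) := fun i j => zigzag_lt b (i : 'I_6) (j : 'I_6).

Fact zigzag_lt_irr : irreflexive lt_zigzag.
Proof. by move=> i; rewrite /lt_zigzag /zigzag_lt ltnn. Qed.

Fact zigzag_lt_trans : transitive lt_zigzag.
Proof.
move=> j i k ij jk; have mem6 (m : 'I_6) : (m : nat) \in iota 0 6.
  by rewrite mem_iota ltn_ord.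
have /allP/(_ _ (mem6 i))/allP/(_ _ (mem6 j))/andP[/allP/(_ _ (mem6 k)) + _] :=
  allP zigzag_lt_check _ (mem_bits b).
by move/implyP; apply; apply/andP.
Qed.

HB.instance Definition _ := Finite.on (zigzag b).
HB.instance Definition _ := @Order.Lt_isPOrder.Build (Order.Disp tt tt)
  (zigzag b) lt_zigzag zigzag_lt_irr zigzag_lt_trans.

Lemma zigzag_path_poset : path_posets 6 (FinPoset (zigzag b : finPOrderType _)).
Proof.
exists (id : 'I_6 -> zigzag b); split; first by exists id.
have mem6 (m : 'I_6) : (m : nat) \in iota 0 6 by rewrite mem_iota ltn_ord.
move=> i j.
have /allP/(_ _ (mem6 i))/allP/(_ _ (mem6 j))/andP[_ /eqP <-] :=
  allP zigzag_lt_check _ (mem_bits b).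
have ex_has (P : pred nat) : [exists z : zigzag b, P (z : 'I_6)] = has P (iota 0 6).
  apply/existsP/hasP => [[z Pz]|[k]]; first by exists (nat_of_ord z); rewrite ?mem6.
  by rewrite mem_iota /= => k6 Pk; exists (Ordinal k6).
by rewrite /hasse /covered_by -!ex_has.
Qed.

(** Comparable indices are joined by a run of steps in one direction, so it is enough to respect the
    five steps; transitivity in [Q] does the rest. *)
Lemma zigzag_weak_subposet (d : Order.disp_t) (Q : finPOrderType d)
    (u : nat -> Q) :
  {in [pred i | (i < 6)%N] &, injective u} ->
  (forall i, (i < 5)%N ->
     if nth false b i then (u i <= u i.+1)%O else (u i.+1 <= u i)%O) ->
  weak_subposet (zigzag b) Q.
Proof.
move=> u_inj u_step.
have up m i : (i + m <= 5)%N -> all id (take m (drop i b)) -> (u i <= u (i + m)%N)%O.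
  elim: m i => [|m IHm] i im; first by rewrite addn0.
  have i5 : (i < 5)%N by lia.
  rewrite (drop_nth false) ?size_tuple //= => /andP[bi /IHm].
  have := u_step _ i5; rewrite bi addnS -addSn => ui; move=> /(_ ltac:(lia)).
  exact: le_trans.
have down m i : (i + m <= 5)%N -> all negb (take m (drop i b)) -> (u (i + m)%N <= u i)%O.
  elim: m i => [|m IHm] i im; first by rewrite addn0.
  have i5 : (i < 5)%N by lia.
  rewrite (drop_nth false) ?size_tuple //= => /andP[/negbTE bi /IHm].
  have := u_step _ i5; rewrite bi addnS -addSn => ui; move=> /(_ ltac:(lia)) uim.
  exact: le_trans uim ui.
exists (fun i : zigzag b => u (i : 'I_6)); split.
  by move=> i j /u_inj ij; apply: val_inj; apply: ij; rewrite inE.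
move=> i j; rewrite le_eqVlt => /predU1P[->//|].
rewrite -[(i < j)%O]/(zigzag_lt b (i : 'I_6) (j : 'I_6)) /zigzag_lt.
have [i6 j6] := (ltn_ord i, ltn_ord j).
case: ltnP => [ij|_ /andP[ji]].
  by move=> /up; rewrite (subnKC (ltnW ij)); apply; lia.
by move=> /down; rewrite (subnKC (ltnW ji)); apply; lia.
Qed.

Lemma zigzag_contains_W_or_M :
  weak_subposet (W_type : finPOrderType _) (zigzag b) \/
  weak_subposet (W_type^d : finPOrderType _) (zigzag b).
Proof.
have /hasP[g] := allP zigzag_WM_check _ (mem_bits b).
rewrite mem_words => /andP[/eqP szg /allP g6] /andP[ug gWM].
have g_lt i : (i < 5)%N -> (nth 0 g i < 6)%N.
  move=> i5; suff: nth 0%N g i \in iota 0 6 by rewrite mem_iota.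
  by apply/g6/mem_nth; rewrite szg.
pose f (i : W_type) : zigzag b := Ordinal (g_lt i (ltn_ord i)).
have f_inj : injective f.
  move=> i j /(congr1 (@nat_of_ord 6)) /= /eqP.
  rewrite nth_uniq ?szg ?ltn_ord // => /eqP; exact: val_inj.
have fE (i j : W_type) : (f i < f j)%O = zigzag_lt b (nth 0%N g i) (nth 0%N g j) by [].
case/orP: gWM => /and4P[h1 h2 h3 h4]; [left|right]; exists f; split=> //.
  move=> x y; rewrite le_eqVlt => /predU1P[->//|xy]; apply: ltW; rewrite fE; move: xy.
  rewrite -[(x < y)%O]/(W_lt x y) /W_lt !inE !xpair_eqE.
  by move=> /or4P[] /andP[/eqP-> /eqP->].
move=> x y; rewrite -[(x <= y)%O]/(W_le y x) /W_le => /predU1P[->//|xy].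
apply: ltW; rewrite fE; move: xy; rewrite /W_lt !inE !xpair_eqE.
by move=> /or4P[] /andP[/eqP-> /eqP->].
Qed.

End ZigzagOrder.

(** * From forbidden posets to comparability graphs *)

Lemma weak_subposet_trans (d1 d2 d3 : Order.disp_t) (P : finPOrderType d1)
    (Q : finPOrderType d2) (S : finPOrderType d3) :
  weak_subposet P Q -> weak_subposet Q S -> weak_subposet P S.
Proof.
move=> [f [f_inj fP]] [g [g_inj gP]]; exists (g \o f); split.
  exact: inj_comp.
by move=> x y /fP/gP.
Qed.

(** Walk along the Hasse path and record the direction of each step; consecutive elements are
    comparable, which is all that [zigzag_weak_subposet] asks for. *)
Lemma path_poset_contains_zigzag (P : finPoset) : path_posets 6 P ->
  exists b : 5.-tuple bool, weak_subposet (zigzag b) (projT2 P).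
Proof.
move=> [v [v_bij v_hasse]]; pose u i := v (inord i).
exists [tuple (u i <= u i.+1)%O | i < 5].
apply: (zigzag_weak_subposet (u := u)).
  move=> i j i6 j6 /(bij_inj v_bij) /(congr1 (@nat_of_ord 6)).
  by rewrite !inordK.
move=> i i5; rewrite -[i]/(nat_of_ord (Ordinal i5)) -tnth_nth tnth_mktuple /=.
case: ifP => //.
have := v_hasse (inord i) (inord i.+1); rewrite !inordK // ?eqxx 1?ltnW //=.
by case/orP => /andP[/ltW]; rewrite -/(u i) -/(u i.+1) // => ->.
Qed.

Lemma WM_free_path_free n (F : {set {set 'I_n}}) :
  family_free family_WM F -> family_free (path_posets 6) F.
Proof.
move=> WMF P /path_poset_contains_zigzag[b zP] PF.
have zF := weak_subposet_trans zP PF.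
have [WZ|MZ] := zigzag_contains_W_or_M b.
  by apply: (WMF poset_W (or_introl erefl)); apply: weak_subposet_trans zF.
by apply: (WMF poset_M (or_intror erefl)); apply: weak_subposet_trans zF.
Qed.

(** Six consecutively comparable sets would contain the zigzag of their directions, itself a
    forbidden path poset. *)
Lemma path_free_no_path n (F : {set {set 'I_n}}) :
  family_free (path_posets 6) F -> no_path (@inclusion_comparable 'I_n) 6 F.
Proof.
move=> freeF p pF ep up; rewrite ltnNge; apply/negP => szp.
have A0F : nth finset.set0 p 0 \in F by apply/pF/mem_nth; apply: leq_trans szp.
pose A i := nth finset.set0 p i.
(* The first set serves as default value; for indices below 6 the default is never taken. *)
pose u i : members F := insubd (exist (fun B => B \in F) _ A0F) (A i).
have uE i : (i < 6)%N -> val (u i) = A i.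
  by move=> i6; rewrite insubdK //; apply/pF/mem_nth; apply: leq_trans szp.
pose b := [tuple (A i \proper A i.+1) | i < 5].
apply: (freeF _ (zigzag_path_poset b)); apply: (zigzag_weak_subposet (u := u)).
  move=> i j i6 j6 /(congr1 val); rewrite !uE // => /eqP.
  by rewrite nth_uniq ?(leq_trans _ szp) // => /eqP.
move=> i i5; rewrite -[i]/(nat_of_ord (Ordinal i5)) -tnth_nth tnth_mktuple /=.
rewrite -![(u _ <= u _)%O]/(val (u _) \subset val (u _)) !uE // 1?ltnW //.
case: ifP => [/proper_sub//|nA].
have /(sortedP finset.set0)/(_ i (leq_trans (i5 : i.+1 < 6)%N szp)) := ep.
by rewrite /inclusion_comparable -/(A _) -/(A _) nA => /proper_sub.
Qed.

(** * The upper bound for fixed [n] and [K] *)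

Lemma num_P2_edge_sum (R : numDomainType) n (F : {set {set 'I_n}}) :
  edge_sum (@inclusion_comparable 'I_n) (fun _ _ => 1) F = (num_P2 F)%:R *+ 2 :> R.
Proof.
have -> : (num_P2 F)%:R = \sum_(A in F) \sum_(B in F | A \proper B) 1 :> R.
  rewrite pair_big_dep /= sumr_const; congr (_ *+ _).
  by apply: eq_card => X; rewrite !inE.
rewrite -edge_sum_oriented /edge_sum; apply: eq_bigr => A _; apply: eq_bigr => B.
move=> /andP[_ /orP[AB|BA]].
  have /negbTE -> : ~~ (B \proper A).
    by apply/negP => /(fintype.proper_trans AB); rewrite fintype.properxx.
  by rewrite AB addr0.
have /negbTE -> : ~~ (A \proper B).
  by apply/negP => /(fintype.proper_trans BA); rewrite fintype.properxx.
by rewrite BA add0r.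
Qed.

Lemma num_P2_path_free (R : realFieldType) n (F : {set {set 'I_n}}) :
  family_free (path_posets 6) F -> (num_P2 F)%:R <= 2 * #|F|%:R :> R.
Proof.
move=> /path_free_no_path nF.
have := Erdos_Gallai_6 R (@inclusion_comparable_sym _)
  (@inclusion_comparable_irr _) nF.
by rewrite num_P2_edge_sum -mulr_natl; lra.
Qed.

(** The first summand bounds the part of [F] of medium size by the chain argument, the second the
    part consisting of extreme sets. *)
Lemma card_path_free (R : realFieldType) n K (F : {set {set 'I_n}}) :
  (4 < K)%N -> (K.*2 <= n)%N -> family_free (path_posets 6) F ->
  #|F|%:R <= ((1 - 4 / K%:R)^-1 + (2 * (K * K))%:R / (n - K).+1%:R)
    * 'C(n, n./2)%:R :> R.
Proof.
move=> K4 Kn /path_free_no_path nF.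
pose X := [set A : {set 'I_n} | (#|A| < K)%N || (n < #|A| + K)%N]%SET.
have K0 : 0 < K%:R :> R by rewrite ltr0n; lia.
have pos : 0 < 1 - 4 / K%:R :> R by rewrite subr_gt0 ltr_pdivrMr // mul1r ltr_nat.
rewrite -(cardsID X F) addnC natrD mulrDl; apply: lerD.
  rewrite mulrC ler_pdivlMr // mulrC; apply: card_no_path6 => //.
    by move=> A; rewrite !inE negb_or -!leqNgt => /andP[/andP[]].
  exact: no_pathS (finset.subsetDl _ _) nF.
rewrite mulrAC ler_pdivlMr ?ltr0n // -!natrM ler_nat -mulnA.
apply: leq_trans (card_extreme_sets Kn); rewrite leq_mul2r.
by rewrite subset_leq_card ?orbT // finset.subsetIr.
Qed.

Lemma La_P2_path6_le (R : realFieldType) n K :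
  (4 < K)%N -> (K.*2 <= n)%N ->
  (La_P2 n (path_posets 6))%:R <=
  2 * ((1 - 4 / K%:R)^-1 + (2 * (K * K))%:R / (n - K).+1%:R)
    * 'C(n, n./2)%:R :> R.
Proof.
move=> K4 Kn; have K0 : 0 < K%:R :> R by rewrite ltr0n; lia.
have pos : 0 < 1 - 4 / K%:R :> R by rewrite subr_gt0 ltr_pdivrMr // mul1r ltr_nat.
rewrite /La_P2; elim/big_ind: _.
- by rewrite !mulr_ge0 // addr_ge0 // ?invr_ge0 ?divr_ge0 // ltW.
- by move=> x y hx hy; rewrite /maxn; case: ifP.
move=> F /asboolP freeF; apply: le_trans (num_P2_path_free R freeF) _.
by rewrite -mulrA ler_pM2l // card_path_free.
Qed.

Lemma La_P2_WM_le_path6 n :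
  (La_P2 n family_WM <= La_P2 n (path_posets 6))%N.
Proof.
apply/bigmax_leqP => F /asboolP freeF.
by apply: leq_bigmax_cond; apply/asboolP/WM_free_path_free.
Qed.

(** * The lower bound construction *)

Definition three_levels n : {set {set 'I_n}} :=
  [set A : {set 'I_n} | (A == finset.set0) || (A == finset.setT) || (#|A| == n./2)]%SET.

Lemma three_levels_WM_free n : family_free family_WM (three_levels n).
Proof.
(* The middle level is an antichain, so only the bottom has two strict upper
   bounds and only the top two strict lower bounds. *)
have lt_val (A B : members (three_levels n)) : (A < B)%O -> val A \proper val B.
  by rewrite lt_neqAle finset.properEneq (inj_eq val_inj) => /andP[-> /= AB].
have up (A B C : members (three_levels n)) :
    (A < B)%O -> (A < C)%O -> B != C -> val A = finset.set0.
  move=> /lt_val AB /lt_val AC; have := valP A; rewrite inE.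
  case/orP => [/orP[/eqP->//|/eqP AT]|/eqP sA BC].
    by move: AB; rewrite AT properE finset.subsetT andbF.
  have top (D : members (three_levels n)) : val A \proper val D -> val D = finset.setT.
    move=> AD; have := proper_card AD; have := valP D; rewrite inE.
    case/orP => [/orP[/eqP->|/eqP->//]|/eqP->]; last by rewrite sA ltnn.
    by rewrite cards0.
  by case/eqP: BC; apply: val_inj; rewrite (top _ AB) (top _ AC).
have down (A B C : members (three_levels n)) :
    (B < A)%O -> (C < A)%O -> B != C -> val A = finset.setT.
  move=> /lt_val BA /lt_val CA; have := valP A; rewrite inE.
  case/orP => [/orP[/eqP A0|/eqP->//]|/eqP sA BC].
    by move: BA; rewrite A0 properE finset.sub0set andbF.
  have bot (D : members (three_levels n)) : val D \proper val A -> val D = finset.set0.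
    move=> DA; have := proper_card DA; have := valP D; rewrite inE.
    case/orP => [/orP[/eqP->//|/eqP->]|/eqP->]; last by rewrite sA ltnn.
    by rewrite ltnNge subset_leq_card // finset.subsetT.
  by case/eqP: BC; apply: val_inj; rewrite (bot _ BA) (bot _ CA).
pose a : W_type := @Ordinal 5 0 isT; pose b : W_type := @Ordinal 5 1 isT.
pose c : W_type := @Ordinal 5 2 isT; pose d : W_type := @Ordinal 5 3 isT.
pose e : W_type := @Ordinal 5 4 isT.
move=> P [->|->] [f [/= f_inj f_homo]].
all: have f_lt x y : (x < y)%O -> (f x < f y)%O
  by rewrite !lt_neqAle (inj_eq f_inj) => /andP[-> /f_homo].
(* In [W] both [b] and [d] have two upper bounds, so both map to the empty set; in [M] both have two
   lower bounds and map to the full set. *)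
all: suff /f_inj : f b = f d by []; apply: val_inj.
  rewrite (up (f b) (f a) (f c)) ?(up (f d) (f c) (f e)) ?(inj_eq f_inj) //; exact: f_lt.
by rewrite (down (f b) (f a) (f c)) ?(down (f d) (f c) (f e)) ?(inj_eq f_inj) //; exact: f_lt.
Qed.

Lemma num_P2_three_levels n : (2 <= n)%N ->
  (2 * 'C(n, n./2) + 1 <= num_P2 (three_levels n))%N.
Proof.
move=> n2; pose M := [set A : {set 'I_n} | #|A| == n./2]%SET.
have cM : #|M| = 'C(n, n./2) by rewrite card_draws card_ord.
(* [2 <= n] puts [n./2] strictly between 0 and [n]. *)
have mid A : A \in M -> A != finset.set0 /\ A != finset.setT.
  rewrite inE => /eqP sA; split; apply: contra_eqN sA => /eqP ->.
    by rewrite cards0; lia.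
  by rewrite cardsT card_ord; lia.
have T0 : finset.setT != finset.set0 :> {set 'I_n}.
  by rewrite -card_gt0 cardsT card_ord; lia.
(* [X0] collects pairs starting at the empty set, one of them ending at the full set, whence the
   extra 1; [X1] collects the pairs from the middle level to the full set. *)
pose X0 := [set (finset.set0 : {set 'I_n}, A) | A in (finset.setT |: M)%SET]%SET.
pose X1 := [set (A, finset.setT : {set 'I_n}) | A in M]%SET.
have c0 : #|X0| = 'C(n, n./2).+1.
  rewrite card_imset; last by move=> ? ? [].
  rewrite cardsU1 cM; case: (boolP (finset.setT \in M)) => // /mid[_].
  by rewrite eqxx.
have c1 : #|X1| = 'C(n, n./2) by rewrite card_imset // => ? ? [].
have X01 : (X0 :&: X1 = finset.set0)%SET.
  apply/setP => X; rewrite !inE; apply/negbTE/negP => /andP[].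
  move=> /imsetP[A _ ->] /imsetP[B /mid[B0 _] [B0' _]].
  by rewrite -B0' eqxx in B0.
have -> : (2 * 'C(n, n./2) + 1 = #|(X0 :|: X1)%SET|)%N.
  by rewrite cardsU X01 cards0 c0 c1; lia.
apply: subset_leq_card; apply/fintype.subsetP => X; rewrite !inE.
case/orP => /imsetP[A + ->] /=.
  rewrite !inE eqxx finset.proper0 => /predU1P[->|AM]; first by rewrite eqxx orbT.
  by rewrite AM orbT; case: (mid A _) => //; rewrite inE.
move=> AM; have [A0 AT] := mid _ AM; move: AM; rewrite inE => ->.
by rewrite eqxx !orbT /= finset.properEneq AT finset.subsetT.
Qed.

Lemma La_P2_WM_ge n : (2 <= n)%N ->
  (2 * 'C(n, n./2) + 1 <= La_P2 n family_WM)%N.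
Proof.
move=> n2; apply: leq_trans (num_P2_three_levels n2) _.
by apply: leq_bigmax_cond; apply/asboolP/three_levels_WM_free.
Qed.

(** * Asymptotics *)

Lemma La_P2_path6_limsup (R : realType) (e : R) : 0 < e ->
  exists N, forall n, (N <= n)%N ->
    (La_P2 n (path_posets 6))%:R <= (2 + e) * 'C(n, n./2)%:R.
Proof.
move=> e0.
(* The choice of [k] gives [4 / (K - 4) <= e / 4], and [m] makes the extreme-set term at most
   [e / 4]; the factor is then at most [2 * (1 + e / 4 + e / 4) = 2 + e]. *)
have [k ke] : exists k : nat, 16 / e <= k%:R.
  by exists (Num.bound (16 / e)); rewrite ltW // archi_boundP // divr_ge0 // ltW.
pose K := (k + 5)%N; pose c : R := (2 * (K * K))%:R.
have [m me] : exists m : nat, 4 * c / e <= m%:R.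
  exists (Num.bound (4 * c / e)); rewrite ltW // archi_boundP // divr_ge0 ?mulr_ge0 //.
  exact: ltW.
exists (K.*2 + m)%N => n Nn.
have K4 : (4 < K)%N by rewrite /K; lia.
have Kn : (K.*2 <= n)%N by lia.
apply: le_trans (La_P2_path6_le R K4 Kn) _; apply: ler_wpM2r => //.
have Kpos : 0 < K%:R :> R by rewrite ltr0n (ltn_trans _ K4).
have K4pos : 0 < K%:R - 4 :> R by rewrite subr_gt0 ltr_nat.
have E1 : (1 - 4 / K%:R)^-1 = 1 + 4 / (K%:R - 4) :> R.
  by field; rewrite !lt0r_neq0.
have E2 : 4 / (K%:R - 4) <= e / 4.
  rewrite ler_pdivrMr // mulrC.
  have : 16 / e <= K%:R - 4 by apply: le_trans ke _; rewrite natrD; lra.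
  by rewrite ler_pdivrMr //; lra.
have E3 : c / (n - K).+1%:R <= e / 4.
  rewrite ler_pdivrMr ?ltr0n // mulrC.
  have : 4 * c / e <= (n - K).+1%:R by apply: le_trans me _; rewrite ler_nat; lia.
  by rewrite ler_pdivrMr //; lra.
move: E2 E3; rewrite E1 -/c; set X := 4 / _; set Y := c / _; lra.
Qed.

Theorem theorem7 (R : realType) :
  exists2 eps : nat -> R, eps n @[n --> \oo] --> (0 : R) &
    forall n : nat, (2 <= n)%N ->
      [/\ (2 * 'C(n, n./2) + 1 <= La_P2 n family_WM)%N,
          (La_P2 n family_WM <= La_P2 n (path_posets 6))%N &
          (La_P2 n (path_posets 6))%:R <= (2 + eps n) * 'C(n, n./2)%:R].
Proof.
have C0 n : 0 < 'C(n, n./2)%:R :> R by rewrite ltr0n bin_gt0; lia.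
(* With [eps] the exact excess, the last bound is an equality. The lower bound makes [eps]
   nonnegative from [n = 2] on, and [La_P2_path6_limsup] sends it to 0. *)
exists (fun n => (La_P2 n (path_posets 6))%:R / 'C(n, n./2)%:R - 2).
  apply/cvgrPdist_le => e e0; have [N leN] := La_P2_path6_limsup e0.
  near=> n; have n2 : (2 <= n)%N by near: n; exact: nbhs_infty_ge.
  rewrite sub0r normrN ger0_norm.
    rewrite lerBlDr addrC ler_pdivrMr // leN //.
    by near: n; exact: nbhs_infty_ge.
  rewrite subr_ge0 ler_pdivlMr // -natrM ler_nat.
  apply: leq_trans (La_P2_WM_le_path6 n); apply: leq_trans (La_P2_WM_ge n2).
  exact: leq_addr.
move=> n n2; split; [exact: La_P2_WM_ge|exact: La_P2_WM_le_path6|].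
by rewrite addrC subrK mulfVK // lt0r_neq0.
Unshelve. all: by end_near. Qed.
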